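(* Let $A\in\mathbb{R}^{n\times n}$ and $B,C^{T}\in\mathbb{R}^{n\times m}$ be such that the system $(A,B,C)$ is minimum phase, i.e. all zeros of the polynomial $\lambda\mapsto\det\begin{bmatrix}A-\lambda I & B\\ C & 0\end{bmatrix}$ lie in the open left half-plane, and such that $(CB)^{T}+CB$ is positive definite. Suppose that: (i) $\mathbb{T}$ is a time scale with $0\in\mathbb{T}$ which is unbounded above and whose graininess $\mu$ satisfies $\mu(t)\le\bar\mu(t)$ for all $t\in\mathbb{T}$, where $$\bar\mu(t):=\frac{1}{k(t)}\left(\frac{\lambda_{\min}\{CB+(CB)^{T}\}}{\lambda_{\max}\{(CB)^{T}CB\}}-\varepsilon_1\right)$$ and $\varepsilon_1>0$ is a constant small enough that $\bar\mu(t)>0$ on $\mathbb{T}$; (ii) $k\in\mathcal{K}$, that is, $k:\mathbb{T}\to\mathbb{R}^{+}$ is rd-continuous, $k^{\Delta}(t)\ge 0$ for all $t\in\mathbb{T}$, and $\lim_{t\to\infty}k(t)=\infty$; (iii) $BC$ is not necessarily of full rank, but there exists $t^{*}\in\mathbb{T}$ such that for all $t\in\mathbb{T}$ with $t\ge t^{*}$ all eigenvalues of $A-k(t)BC$ have strictly negative real part. Then the closed-loop system $$x^{\Delta}(t)=\operatorname{expc}(\mu(t)A)\,(A-k(t)BC)\,x(t),\qquad x(0)=x_0\in\mathbb{R}^n,\qquad t\in\mathbb{T},\ t\ge 0,$$ is exponentially stable in the sense that there exist $t_0\in\mathbb{T}$ and constants $K=K(t_0)\ge 1$ and $\alpha>0$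 such that its solutions satisfy $$\|x(t)\|\le \|x(t_0)\|\,K\,e^{-\frac12\alpha(t-t_0)}\qquad\text{for all } t\in\mathbb{T},\ t\ge t_0.$$
   Context: A time scale $\mathbb{T}$ is a nonempty closed subset of $\mathbb{R}$. For $t\in\mathbb{T}$ the forward jump is $\sigma(t)=\inf\{s\in\mathbb{T}:s>t\}$ and the graininess is $\mu(t)=\sigma(t)-t\ge0$. The delta derivative $f^{\Delta}(t)$ is the (Hilger) derivative: $f^\Delta(t)=(f(\sigma(t))-f(t))/\mu(t)$ if $\mu(t)>0$, and $f^\Delta(t)=\lim_{s\to t,\,s\in\mathbb{T}}(f(t)-f(s))/(t-s)$ if $\mu(t)=0$. A function on $\mathbb{T}$ is rd-continuous if it is continuous at right-dense points ($\sigma(t)=t$) and has finite left-sided limits at left-dense points. $\mathbb{R}^+$ denotes the positive reals. For a square matrix $X$, $\operatorname{expc}(X):=\sum_{j=1}^{\infty}\frac{1}{j!}X^{j-1}=I+\frac12X+\frac16X^2+\cdots$. The closed-loop system arises from $x^{\Delta}=\hat A x+\hat B u$, $y=Cx$, with $\hat A(t)=\operatorname{expc}(\mu(t)A)A$, $\hat B(t)=\operatorname{expc}(\mu(t)A)B$, under the output feedback $u(t)=-k(t)y(t)$. $\lambda_{\min}$ and $\lambda_{\max}$ denote the smallest and largest eigenvalue of a symmetric matrix. *)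

(* Defs.v *)
From mathcomp Require Import all_boot all_order all_algebra.
From mathcomp Require Import complex.
From mathcomp Require Import all_classical all_reals all_analysis.

Set Implicit Arguments.
Unset Strict Implicit.
Unset Printing Implicit Defensive.

Import Order.TTheory GRing.Theory Num.Theory.
Import numFieldNormedType.Exports.

Local Open Scope classical_set_scope.
Local Open Scope ring_scope.

(* Functions on a time scale T are represented by total functions on R;
   no definition below looks at their values outside T. *)

Definition time_scale (R : realType) (T : set R) : Prop :=
  T !=set0 /\ closed T.

(* The set whose infimum is taken is empty only when t is the maximum of T;
   the usual convention sigma (max T) = max T is not encoded (inf set0 = 0), so
   sigma is only meaningful there when T is unbounded above. *)
Definition sigma (R : realType) (T : set R) (t : R) : R :=
  inf [set s | T s /\ t < s].

Definition mu (R : realType) (T : set R) (t : R) : R := sigma T t - t.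

Definition right_dense (R : realType) (T : set R) (t : R) : Prop :=
  sigma T t = t.

Definition left_dense (R : realType) (T : set R) (t : R) : Prop :=
  closure (T `&` [set s | s < t]) t.

Definition is_delta_derive (R : realType) (V : normedModType R)
    (T : set R) (f : R -> V) (t : R) (l : V) : Prop :=
  (0 < mu T t -> l = (mu T t)^-1 *: (f (sigma T t) - f t)) /\
  (mu T t = 0 ->
     (fun s => (t - s)^-1 *: (f t - f s)) @ within T t^' --> l).

Definition continuous_at_on (R : realType) (V : normedModType R)
    (T : set R) (f : R -> V) (t : R) : Prop :=
  f @ within T (nbhs t) --> f t.

Definition rd_continuous (R : realType) (V : normedModType R)
    (T : set R) (f : R -> V) : Prop :=
  (forall t, T t -> right_dense T t -> continuous_at_on T f t) /\
  (forall t, T t -> left_dense T t ->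
     exists l : V, f @ within T (t^'-) --> l).

Definition class_K (R : realType) (T : set R) (k : R -> R) : Prop :=
  [/\ forall t, T t -> 0 < k t,
      rd_continuous T (k : R -> R^o),
      forall t, T t ->
        exists2 l : R, is_delta_derive T (k : R -> R^o) t l & 0 <= l
    & k @ within T (pinfty_nbhs R) --> +oo].

Definition expc (R : realType) (n : nat) (X : 'M[R]_n.+1) : 'M[R]_n.+1 :=
  lim (series (fun j : nat => (j.+1`!%:R)^-1 *: X ^+ j) @ \oo).

(* For a symmetric real matrix the set of eigenvalues is finite and nonempty,
   so that these bounds are its least and greatest elements. *)
Definition lambda_min (R : realType) (n : nat) (S : 'M[R]_n.+1) : R :=
  inf [set a | eigenvalue S a].

Definition lambda_max (R : realType) (n : nat) (S : 'M[R]_n.+1) : R :=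
  sup [set a | eigenvalue S a].

Definition pos_def (R : realType) (n : nat) (S : 'M[R]_n.+1) : Prop :=
  forall v : 'cV[R]_n.+1, v != 0 -> 0 < (v^T *m S *m v) 0 0.

Definition system_poly (R : realType) (n m : nat) (A : 'M[R]_n.+1)
    (B : 'M[R]_(n.+1, m.+1)) (C : 'M[R]_(m.+1, n.+1)) : {poly R} :=
  \det (block_mx (map_mx polyC A - 'X%:M) (map_mx polyC B)
                 (map_mx polyC C)         0).

Definition minimum_phase (R : realType) (n m : nat) (A : 'M[R]_n.+1)
    (B : 'M[R]_(n.+1, m.+1)) (C : 'M[R]_(m.+1, n.+1)) : Prop :=
  forall z : R[i],
    root (map_poly (real_complex R) (system_poly A B C)) z ->
    complex.Re z < 0.

(* The eigenvalues of the real matrix M are its complex ones. *)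
Definition hurwitz (R : realType) (n : nat) (M : 'M[R]_n.+1) : Prop :=
  forall z : R[i], eigenvalue (map_mx (real_complex R) M) z ->
    complex.Re z < 0.

Definition mubar (R : realType) (n m : nat) (B : 'M[R]_(n.+1, m.+1))
    (C : 'M[R]_(m.+1, n.+1)) (k : R -> R) (eps1 : R) (t : R) : R :=
  (k t)^-1 * (lambda_min (C *m B + (C *m B)^T)
                / lambda_max ((C *m B)^T *m (C *m B)) - eps1).

(* Solutions live on the time scale T `&` `[0, +oo[. Delta differentiable
   functions are continuous; at a left-dense point with mu > 0 this does not
   follow from the difference quotient formula in is_delta_derive, whence the
   explicit continuity requirement. *)
Definition closed_loop_solution (R : realType) (n m : nat) (T : set R)
    (A : 'M[R]_n.+1) (B : 'M[R]_(n.+1, m.+1)) (C : 'M[R]_(m.+1, n.+1))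
    (k : R -> R) (x0 : 'cV[R]_n.+1) (x : R -> 'cV[R]_n.+1) : Prop :=
  let T0 := T `&` [set t | 0 <= t] in
  x 0 = x0 /\
  forall t, T0 t ->
    continuous_at_on T0 x t /\
    is_delta_derive T0 x t
      (expc (mu T t *: A) *m (A - k t *: (B *m C)) *m x t).

(* The norm `|x| of 'cV[R]_n is the sup norm. *)
Definition enorm (R : realType) (n : nat) (x : 'cV[R]_n.+1) : R :=
  Num.sqrt (\sum_i x i 0 ^+ 2).

(* Main.v *)
From HB Require Import structures.
Require Import Defs.
From mathcomp Require Import all_boot all_order all_algebra.
From mathcomp Require Import complex spectral mxred ring lra.
From mathcomp Require Import all_classical all_reals all_analysis.
Set Implicit Arguments.
Unset Strict Implicit.
Unset Printing Implicit Defensive.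
Import Order.TTheory GRing.Theory Num.Theory.
Import numFieldNormedType.Exports.
Local Open Scope classical_set_scope.
Local Open Scope ring_scope.

(** The gain k drives the output y = C x to zero, and what remains is the zero
    dynamics, which the minimum phase assumption makes stable. A single
    quadratic Lyapunov function shows both at once.

    Let D = CB. Since D + D^T is positive definite, D is invertible, and
    Pi = 1 - B D^-1 C is the projection onto ker C along im B. Every state
    splits as x = z + B D^-1 y with y = C x and z = Pi x. The matrix
    F = Pi A Pi - B D^-1 C acts as the zero dynamics on ker C and as -1 on
    im B. An eigenvector of F for an eigenvalue other than -1 yields a vector
    in the kernel of the system matrix, so minimum phase makes F Hurwitz
    ([minimum_phase_hurwitz]), and F has a Lyapunov matrix P ([lyapunov]).

    Put V(x) = |y|^2 + z^T P z. If x moves with velocity f over a step of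
    length r, then V grows by r (2 <x, f>_V + r <f, f>_V), where <., .>_V is
    the bilinear form of V; for r = 0 the factor is the derivative. So a single
    estimate of this factor treats right-scattered and right-dense points alike.
    As expc(rA) = 1 + O(r) and r k stays bounded, replacing expc(rA) by 1 costs
    O(|y| + r |z|). In the y-direction the factor is
      - k y^T (D + D^T) y + r k^2 |D y|^2 + lower order terms,
    and the bound imposed on the graininess makes the two displayed terms at
    most - k eps1 lambda_max |y|^2. In the z-direction P contributes - g |z|^2.
    A large k and the small r that comes with it absorb the cross terms
    ([high_gain_absorption]), which leaves - a V ([closed_loop_quadratic]).

    On a time scale such a decrement forces exponential decay of V
    ([time_scale_comparison]), and V is equivalent to the squared norm. *)

(** * Euclidean forms *)

Definition dot (R : pzRingType) (n : nat) (x y : 'cV[R]_n) : R := (x^T *m y) 0 0.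

Lemma dotE (R : pzRingType) n (x y : 'cV[R]_n) : dot x y = \sum_i x i 0 * y i 0.
Proof. by rewrite /dot mxE; apply: eq_bigr => i _; rewrite mxE. Qed.

Lemma dotC (R : comPzRingType) n (x y : 'cV[R]_n) : dot x y = dot y x.
Proof. by rewrite !dotE; apply: eq_bigr => i _; rewrite mulrC. Qed.

Lemma dotDr (R : pzRingType) n (x y z : 'cV[R]_n) :
  dot x (y + z) = dot x y + dot x z.
Proof. by rewrite /dot mulmxDr mxE. Qed.

Lemma dotDl (R : pzRingType) n (x y z : 'cV[R]_n) :
  dot (x + y) z = dot x z + dot y z.
Proof. by rewrite /dot linearD mulmxDl mxE. Qed.

Lemma dotZr (R : comPzRingType) n (a : R) (x y : 'cV[R]_n) :
  dot x (a *: y) = a * dot x y.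
Proof. by rewrite /dot -scalemxAr mxE. Qed.

Lemma dotZl (R : comPzRingType) n (a : R) (x y : 'cV[R]_n) :
  dot (a *: x) y = a * dot x y.
Proof. by rewrite dotC dotZr dotC. Qed.

Lemma dot_mulmx (R : comPzRingType) n m (x : 'cV[R]_n) (M : 'M[R]_(n, m))
  (y : 'cV[R]_m) : dot x (M *m y) = dot (M^T *m x) y.
Proof. by rewrite /dot trmx_mul trmxK mulmxA. Qed.

Lemma dot_ge0 (R : realDomainType) n (x : 'cV[R]_n) : 0 <= dot x x.
Proof. by rewrite dotE sumr_ge0// => i _; rewrite -expr2 sqr_ge0. Qed.

Lemma dot_eq0 (R : realDomainType) n (x : 'cV[R]_n) : dot x x = 0 -> x = 0.
Proof.
rewrite dotE => /eqP; rewrite psumr_eq0; last first.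
  by move=> i _; rewrite -expr2 sqr_ge0.
move=> /allP x0; apply/matrixP => i j; rewrite ord1 mxE; apply/eqP.
by have := x0 i (mem_index_enum i); rewrite -expr2 sqrf_eq0.
Qed.

Lemma dot_gt0 (R : realDomainType) n (x : 'cV[R]_n) : x != 0 -> 0 < dot x x.
Proof.
move=> x0; rewrite lt_neqAle dot_ge0 andbT eq_sym.
by apply: contra_neq x0 => /dot_eq0.
Qed.

(** * Real quadratic forms through complex unitary coordinates *)

Section complex_coordinates.
Context {R : realType}.
Local Notation toC := (real_complex R).
Local Notation Cx := R[i].

Lemma Re_sum (I : Type) (r : seq I) (P : pred I) (F : I -> Cx) :
  complex.Re (\sum_(i <- r | P i) F i) = \sum_(i <- r | P i) complex.Re (F i).
Proof. by elim/big_rec2: _ => // i y1 y2 _ <-; case: (F i) y2 => ? ? []. Qed.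

Definition Cnorm2 (z : Cx) : R := complex.Re z ^+ 2 + complex.Im z ^+ 2.

Lemma Cnorm2_ge0 z : 0 <= Cnorm2 z.
Proof. by rewrite addr_ge0 ?sqr_ge0. Qed.

Lemma conjC_mul_Cnorm2 (z : Cx) : z^* * z = toC (Cnorm2 z).
Proof.
case: z => a b; apply/eqP; rewrite eq_complex /Cnorm2 /=.
by apply/andP; split; apply/eqP; ring.
Qed.

Lemma Re_conjC_mulmul (t z : Cx) :
  complex.Re (z^* * (t * z)) = complex.Re t * Cnorm2 z.
Proof. by case: t z => a b [c d]; rewrite /Cnorm2 /=; ring. Qed.

Lemma Re_toC_mul (a : R) (z : Cx) : complex.Re (toC a * z) = a * complex.Re z.
Proof. by case: z => c d /=; ring. Qed.

(** A bound on the real part that avoids complex absolute values: only squared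
    moduli, which are polynomial in the coordinates, appear. *)
Lemma Re_le_Cnorm2 (z : Cx) (a : R) : 0 <= a -> Cnorm2 z <= a ^+ 2 ->
  complex.Re z <= a.
Proof.
move=> a0 za; have [z0|z0] := ltP (complex.Re z) 0.
  by rewrite (le_trans (ltW z0)).
rewrite -(@ler_pXn2r _ 2)// ?nnegrE//; apply: le_trans za.
by rewrite lerDl sqr_ge0.
Qed.

Lemma Cnorm2M (z t : Cx) : Cnorm2 (z * t) = Cnorm2 z * Cnorm2 t.
Proof. by case: z t => a b [c d]; rewrite /Cnorm2 /=; ring. Qed.

Lemma Cnorm2_conj (z : Cx) : Cnorm2 (z^*) = Cnorm2 z.
Proof. by case: z => a b; rewrite /Cnorm2 /=; ring. Qed.

Lemma Cnorm2_toC (a : R) : Cnorm2 (toC a) = a ^+ 2.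
Proof. by rewrite /Cnorm2 /=; ring. Qed.

End complex_coordinates.

(** * Schur coordinates *)

Section unitary_coordinates.
Context {R : realType}.
Local Notation toC := (real_complex R).
Local Notation Cx := R[i].

(** The real part of the Hermitian matrix G^* diag(w) G. On real vectors it has
    the same quadratic form as the Hermitian matrix, which brings forms
    diagonalised over the complex numbers back to the reals. *)
Definition herm_re n (G : 'M[Cx]_n) (w : 'I_n -> R) : 'M[R]_n :=
  \matrix_(i, j) complex.Re (\sum_k toC (w k) * ((G k i)^* * G k j)).

Lemma tr_herm_re n (G : 'M[Cx]_n) w : (herm_re G w)^T = herm_re G w.
Proof.
apply/matrixP => i j; rewrite !mxE !Re_sum; apply: eq_bigr => k _.
rewrite !Re_toC_mul; congr (_ * _).
by case: (G k i) (G k j) => a b [c d] /=; ring.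
Qed.

Lemma dot_herm_re n (G : 'M[Cx]_n) w (x y : 'cV[R]_n) :
  dot x (herm_re G w *m y) =
  \sum_k w k * complex.Re (((G *m map_mx toC x) k 0)^* * (G *m map_mx toC y) k 0).
Proof.
rewrite dotE.
under eq_bigr => i _.
  rewrite mxE mulr_sumr.
  under eq_bigr => j _.
    rewrite mxE Re_sum mulr_suml mulr_sumr.
    over.
  over.
under eq_bigr => i _ do rewrite exchange_big /=.
rewrite exchange_big /=; apply: eq_bigr => k _.
rewrite !mxE rmorph_sum/= mulr_suml Re_sum mulr_sumr.
apply: eq_bigr => i _; rewrite mulr_sumr Re_sum mulr_sumr.
apply: eq_bigr => j _; rewrite !mxE Re_toC_mul.
by case: (G k i) (G k j) => a b [c d] /=; ring.
Qed.

Lemma unitary_herm_re n (U : 'M[Cx]_n) : U \is unitarymx ->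
  herm_re U (fun=> 1) = 1%:M.
Proof.
move=> Uu.
have : invmx U *m U = 1%:M by rewrite mulVmx// unitarymx_unit.
rewrite invmx_unitary// => /matrixP UU.
apply/matrixP => i j; have := UU i j; rewrite !mxE => UUij.
rewrite Re_sum; under eq_bigr do rewrite Re_toC_mul mul1r.
rewrite -Re_sum; transitivity (complex.Re ((i == j)%:R : Cx)); last first.
  by case: eqP.
by rewrite -UUij; congr complex.Re; apply: eq_bigr => k _; rewrite !mxE.
Qed.

Lemma dot_unitary n (U : 'M[Cx]_n) (x y : 'cV[R]_n) : U \is unitarymx ->
  dot x y = \sum_k
    complex.Re (((U *m map_mx toC x) k 0)^* * (U *m map_mx toC y) k 0).
Proof.
move=> /unitary_herm_re U1; rewrite -[in LHS](mul1mx y) -U1 dot_herm_re.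
by apply: eq_bigr => k _; rewrite mul1r.
Qed.

Lemma dot_unitary_Cnorm2 n (U : 'M[Cx]_n) (x : 'cV[R]_n) : U \is unitarymx ->
  dot x x = \sum_k Cnorm2 ((U *m map_mx toC x) k 0).
Proof.
move=> Uu; rewrite (dot_unitary x x Uu); apply: eq_bigr => k _.
by rewrite conjC_mul_Cnorm2.
Qed.

Lemma sum_diag_pairs n (a : 'I_n -> R) (g c : R) :
  \sum_i \sum_j ((if j == i then g * a i else 0) + c * ((a i + a j) / 2)) =
  (g + c * n%:R) * \sum_i a i.
Proof.
transitivity (\sum_i (g * a i + c * (n%:R * a i + \sum_j a j) / 2)).
  apply: eq_bigr => i _; rewrite big_split /= -big_mkcond /= big_pred1_eq.
  congr (_ + _); rewrite -mulr_sumr -mulr_suml big_split /= sumr_const card_ord.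
  rewrite -[_ *+ n]mulr_natl. by rewrite mulrA.
rewrite big_split /= -mulr_sumr -mulr_suml -mulr_sumr big_split /=.
by rewrite sumr_const card_ord -mulr_sumr -[_ *+ n]mulr_natl; field.
Qed.

(** Giving the i-th coordinate the weight d^(2i) multiplies the entry T i j below
    the diagonal by d^(i-j), hence by at most d. For d small the diagonal part,
    whose real parts are bounded away from zero, dominates. *)
Lemma trig_dissipative n (T : 'M[Cx]_n) : is_trig_mx T ->
  (forall i, complex.Re (T i i) < 0) ->
  exists (w : 'I_n -> R) (p g : R), [/\ 0 < p, 0 < g, forall i, p <= w i &
    forall y : 'cV[Cx]_n,
      \sum_i w i * complex.Re ((y i 0)^* * (T *m y) i 0)
      <= - g * \sum_i Cnorm2 (y i 0)].
Proof.
move=> /is_trig_mxP Ttrig Tneg.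
pose g := \big[Order.min/1]_i (- complex.Re (T i i)).
have g0 : 0 < g by apply: lt_bigmin => // i _; rewrite oppr_gt0.
have Tg i : complex.Re (T i i) <= - g by rewrite lerNr; exact: bigmin_le_cond.
pose M : R := 1 + \sum_i \sum_j Cnorm2 (T i j).
have M1 : 1 <= M.
  by rewrite lerDl sumr_ge0// => i _; rewrite sumr_ge0// => j _; exact: Cnorm2_ge0.
have TM i j : Cnorm2 (T i j) <= M ^+ 2.
  apply: (@le_trans _ _ M); last by rewrite expr2 ler_peMr// (le_trans _ M1).
  rewrite /M (bigD1 i)//= (bigD1 j)//=.
  rewrite addrCA -addrA lerDl addr_ge0//.
    by rewrite sumr_ge0// => *; exact: Cnorm2_ge0.
  rewrite addr_ge0// sumr_ge0// => k _.
  by rewrite sumr_ge0// => *; exact: Cnorm2_ge0.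
(* Any d <= 1 with M d n <= g / 2 would do: the off-diagonal terms then eat at
   most half of the diagonal decay. *)
pose d := g / (2 * M * n.+1%:R + g).
have den0 : 0 < 2 * M * n.+1%:R + g.
  by rewrite addr_gt0// !mulr_gt0// (lt_le_trans _ M1).
have d0 : 0 < d by rewrite divr_gt0.
have d1 : d <= 1.
  by rewrite ler_pdivrMr// mul1r lerDr !mulr_ge0// (le_trans _ M1).
have Md : M * d * n%:R <= g / 2.
  rewrite /d mulrA mulrAC ler_pdivrMr//.
  rewrite -[n.+1%:R]natr1; have gM : 0 <= g * M by rewrite mulr_ge0 ?(ltW g0)// (le_trans _ M1).
  have g2 := sqr_ge0 g; rewrite expr2 in g2.
  move: n%:R => N; nra.
pose s (i : 'I_n) := d ^+ i.
have s0 i : 0 < s i by exact: exprn_gt0.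
have sle (i j : 'I_n) : (j < i)%N -> s i <= d * s j.
  by move=> ji; rewrite -exprS; apply: ler_wiXn2l => //; exact: ltW.
exists (fun i => s i ^+ 2), ((d ^+ n) ^+ 2), (g / 2 * (d ^+ n) ^+ 2).
have ps i : (d ^+ n) ^+ 2 <= s i ^+ 2.
  rewrite ler_pXn2r ?nnegrE ?exprn_ge0 ?(ltW d0)//.
  by apply: ler_wiXn2l; rewrite ?(ltW d0)// ltnW.
split => //; first by rewrite !exprn_gt0.
  by rewrite !mulr_gt0 ?exprn_gt0.
move=> y; pose a i := s i ^+ 2 * Cnorm2 (y i 0).
have a0 i : 0 <= a i by rewrite mulr_ge0 ?sqr_ge0 ?Cnorm2_ge0.
have term i j : s i ^+ 2 * complex.Re ((y i 0)^* * (T i j * y j 0)) <=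
    (if j == i then - g * a i else 0) + M * d * ((a i + a j) / 2).
  have rhs0 : 0 <= M * d * ((a i + a j) / 2).
    apply: mulr_ge0; first by rewrite mulr_ge0 ?(ltW d0)// (le_trans _ M1).
    by rewrite divr_ge0 ?addr_ge0 ?a0.
  case: (ltngtP i j) => [ij|ji|/val_inj ij].
  - by rewrite Ttrig// mul0r mulr0 /= mulr0; case: eqP ij => [->|_ _]; rewrite ?ltnn// add0r.
  - case: eqP ji => [->|_ ji]; rewrite ?ltnn// add0r -Re_toC_mul.
    apply: Re_le_Cnorm2 => //.
    rewrite !Cnorm2M Cnorm2_conj Cnorm2_toC.
    set Ni := Cnorm2 (y i 0); set Nj := Cnorm2 (y j 0).
    have Ni0 : 0 <= Ni by exact: Cnorm2_ge0.
    have Nj0 : 0 <= Nj by exact: Cnorm2_ge0.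
    apply: (@le_trans _ _ (M ^+ 2 * d ^+ 2 * (a i * a j))).
      have -> : (s i ^+ 2) ^+ 2 * (Ni * (Cnorm2 (T i j) * Nj)) =
        Cnorm2 (T i j) * s i ^+ 2 * (s i ^+ 2 * Ni * Nj) by ring.
      have -> : M ^+ 2 * d ^+ 2 * (a i * a j) =
        M ^+ 2 * (d * s j) ^+ 2 * (s i ^+ 2 * Ni * Nj).
        by rewrite /a -/Ni -/Nj; ring.
      apply: ler_wpM2r; first by rewrite !mulr_ge0 ?(ltW (s0 i)).
      apply: ler_pM; rewrite ?Cnorm2_ge0 ?sqr_ge0 ?TM//.
      rewrite ler_pXn2r ?sle// nnegrE ?(ltW (s0 i))//.
      by rewrite mulr_ge0 ?(ltW (s0 j)) ?(ltW d0).
    rewrite [leRHS]exprMn [(M * d) ^+ 2]exprMn ler_wpM2l//.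
      by rewrite mulr_ge0 ?sqr_ge0.
    by have := sqr_ge0 (a i - a j); nra.
  - subst j; rewrite eqxx Re_conjC_mulmul.
    suff : s i ^+ 2 * (complex.Re (T i i) * Cnorm2 (y i 0)) <= - g * a i.
      by move=> /le_trans; apply; rewrite lerDl.
    by rewrite mulrCA; exact: ler_wpM2r (a0 i) _ _ (Tg i).
apply: (@le_trans _ _ (\sum_i \sum_j
    ((if j == i then - g * a i else 0) + M * d * ((a i + a j) / 2)))).
  apply: ler_sum => i _; rewrite mxE mulr_sumr Re_sum mulr_sumr.
  by apply: ler_sum => j _; exact: term.
rewrite sum_diag_pairs.
apply: (@le_trans _ _ (- (g / 2) * \sum_i a i)).
  rewrite ler_wpM2r ?sumr_ge0//; lra.
rewrite !mulNr lerN2 -[leLHS]mulrA.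
apply: ler_wpM2l; first by rewrite divr_ge0 ?(ltW g0).
rewrite mulr_sumr; apply: ler_sum => i _.
by rewrite /a ler_wpM2r// Cnorm2_ge0.
Qed.

End unitary_coordinates.

(** * Lyapunov matrices and extreme eigenvalues *)

Section lyapunov.
Context {R : realType}.
Local Notation toC := (real_complex R).
Local Notation Cx := R[i].

(** In Schur coordinates the matrix is triangular with its eigenvalues on the
    diagonal, and the weighted squared norm there is a Lyapunov function; its
    real part is one for the real matrix. *)
Lemma lyapunov n (F : 'M[R]_n.+1) : hurwitz F ->
  exists (P : 'M[R]_n.+1) (p g : R), [/\ P^T = P, 0 < p, 0 < g,
    forall x : 'cV_n.+1, p * dot x x <= dot x (P *m x) &
    forall x : 'cV_n.+1, dot x (P *m (F *m x)) <= - g * dot x x].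
Proof.
move=> hF; have [//|U Uu /= UF] := @Schur _ _ (map_mx toC F).
have Uunit := unitarymx_unit Uu.
set T := conjmx U (map_mx toC F) in UF.
have UT : U *m map_mx toC F = T *m U.
  by rewrite /T conjumx// mulmxKV.
have Tneg i : complex.Re (T i i) < 0.
  apply: hF; apply: (@eigenvalue_conjmx _ _ _ U).
  - exact: stablemx_unit.
  - by rewrite row_free_unit.
  change (eigenvalue T (T i i)); rewrite eigenvalue_root_char char_poly_trig//.
  rewrite /root horner_prod prodf_seq_eq0; apply/hasP.
  exists i; first exact: mem_index_enum.
  by rewrite hornerXsubC subrr eqxx.
have [w [p [g [p0 g0 pw Hw]]]] := trig_dissipative UF Tneg.
exists (herm_re U w), p, g; split => //.
- exact: tr_herm_re.
- move=> x; rewrite dot_herm_re (dot_unitary_Cnorm2 x Uu) mulr_sumr.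
  apply: ler_sum => k _; rewrite conjC_mul_Cnorm2 /=.
  by rewrite ler_wpM2r// Cnorm2_ge0.
- move=> x; rewrite dot_herm_re map_mxM mulmxA UT -mulmxA.
  by rewrite (dot_unitary_Cnorm2 x Uu); exact: Hw.
Qed.

(** The eigenvalues d i are real and lie in the spectrum of S over the reals,
    which is where lambda_min and lambda_max take their extrema. *)
Lemma sym_spectral n (S : 'M[R]_n.+1) : S^T = S ->
  exists (U : 'M[Cx]_n.+1) (d : 'I_n.+1 -> R), [/\ U \is unitarymx,
    forall i, eigenvalue S (d i) &
    forall x : 'cV_n.+1,
      dot x (S *m x) = \sum_i d i * Cnorm2 ((U *m map_mx toC x) i 0)].
Proof.
move=> Ssym; pose SC := map_mx toC S.
have SCherm : SC \is hermsymmx.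
  apply: realsym_hermsym.
    apply/is_hermitianmxP; rewrite expr0 scale1r map_mx_id//.
    by rewrite map_trmx Ssym.
  by apply/mxOverP => i j; rewrite mxE complex_real.
have /orthomx_spectralP := hermitian_normalmx SCherm.
have /mxOverP := hermitian_spectral_diag_real SCherm.
set U := spectralmx SC; set D := spectral_diag SC => Dreal SCE.
have Uu : U \is unitarymx by exact: spectral_unitarymx.
have Uunit := unitarymx_unit Uu.
have US : U *m SC = diag_mx D *m U by rewrite {1}SCE -mulmxA mulKVmx.
exists U, (fun i => complex.Re (D 0 i)); split => //.
- move=> i; rewrite -(eigenvalue_map toC) /=.
  have -> : toC (complex.Re (D 0 i)) = D 0 i by exact: RRe_real.
  apply: (@eigenvalue_conjmx _ _ _ U).
  + exact: stablemx_unit.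
  + by rewrite row_free_unit.
  change (eigenvalue (conjmx U SC) (D 0 i)).
  have -> : conjmx U SC = diag_mx D.
    by rewrite conjumx// US mulmxK.
  rewrite eigenvalue_root_char char_poly_trig ?diag_mx_is_trig//.
  rewrite /root horner_prod prodf_seq_eq0; apply/hasP.
  exists i; first exact: mem_index_enum.
  by rewrite hornerXsubC mxE eqxx mulr1n subrr eqxx.
- move=> x; rewrite (dot_unitary _ _ Uu); apply: eq_bigr => k _.
  rewrite map_mxM mulmxA US -mulmxA mul_diag_mx mxE.
  exact: Re_conjC_mulmul.
Qed.

(** Bounds the spectrum by the Rayleigh quotient, so that the infimum and the
    supremum defining lambda_min and lambda_max are genuine. *)
Lemma eigenvalue_dot n (S : 'M[R]_n.+1) (a : R) : S^T = S -> eigenvalue S a ->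
  exists2 x : 'cV_n.+1, 0 < dot x x & dot x (S *m x) = a * dot x x.
Proof.
move=> Ssym /eigenvalueP[v vS v0]; exists v^T.
  by rewrite dot_gt0// trmx_eq0.
by rewrite -dotZr -{1}Ssym -trmx_mul vS linearZ.
Qed.

Lemma lambda_min_le n (S : 'M[R]_n.+1) (x : 'cV_n.+1) : S^T = S ->
  lambda_min S * dot x x <= dot x (S *m x).
Proof.
move=> Ssym; have [U [d [Uu dS SE]]] := sym_spectral Ssym.
have lower (b : R) y : (forall i, b <= d i) -> b * dot y y <= dot y (S *m y).
  move=> bd; rewrite SE (dot_unitary_Cnorm2 y Uu) mulr_sumr.
  by apply: ler_sum => i _; rewrite ler_wpM2r// Cnorm2_ge0.
apply: (lower _ x) => i; apply: ge_inf; last exact: dS.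
exists (\big[Order.min/d ord0]_i d i) => a /(eigenvalue_dot Ssym)[y y0 ya].
rewrite -(ler_pM2r y0) -ya; apply: lower => j.
exact: bigmin_le_cond.
Qed.

Lemma lambda_max_ge n (S : 'M[R]_n.+1) (x : 'cV_n.+1) : S^T = S ->
  dot x (S *m x) <= lambda_max S * dot x x.
Proof.
move=> Ssym; have [U [d [Uu dS SE]]] := sym_spectral Ssym.
have upper (b : R) y : (forall i, d i <= b) -> dot y (S *m y) <= b * dot y y.
  move=> bd; rewrite SE (dot_unitary_Cnorm2 y Uu) mulr_sumr.
  by apply: ler_sum => i _; rewrite ler_wpM2r// Cnorm2_ge0.
apply: (upper _ x) => i; apply: ub_le_sup; last exact: dS.
exists (\big[Order.max/d ord0]_i d i) => a /(eigenvalue_dot Ssym)[y y0 ya].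
rewrite -(ler_pM2r y0) -ya; apply: upper => j.
exact: le_bigmax_cond.
Qed.

End lyapunov.

(** * Stability of the zero dynamics *)

Lemma horner_system_poly (R : realType) n m (A : 'M[R]_n.+1)
    (B : 'M[R]_(n.+1, m.+1)) (C : 'M[R]_(m.+1, n.+1)) (z : R[i]) :
  (map_poly (real_complex R) (system_poly A B C)).[z] =
  \det (block_mx (map_mx (real_complex R) A - z%:M) (map_mx (real_complex R) B)
          (map_mx (real_complex R) C) 0).
Proof.
pose f : {rmorphism {poly R} -> R[i]} := horner_eval z \o map_poly (real_complex R).
rewrite -[LHS]/(f (system_poly A B C)) /system_poly -det_map_mx map_block_mx.
congr (\det (block_mx _ _ _ _)); apply/matrixP => i j; rewrite !mxE /= /horner_eval.
- by rewrite rmorphB rmorphMn/= map_polyC map_polyX hornerD hornerN hornerMn hornerX hornerC.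
- by rewrite map_polyC hornerC.
- by rewrite map_polyC hornerC.
- by rewrite rmorph0 horner0.
Qed.

(** With Q = B (CB)^-1 C, a left eigenvector v for an eigenvalue z other than -1
    satisfies v Q = 0, hence v B = 0, and then the row (v, - v A B (CB)^-1)
    annihilates the system matrix at z. *)
Lemma minimum_phase_hurwitz (R : realType) n m (A : 'M[R]_n.+1)
    (B : 'M[R]_(n.+1, m.+1)) (C : 'M[R]_(m.+1, n.+1)) :
  C *m B \in unitmx -> minimum_phase A B C ->
  hurwitz ((1%:M - B *m invmx (C *m B) *m C) *m A *m
             (1%:M - B *m invmx (C *m B) *m C) - B *m invmx (C *m B) *m C).
Proof.
move=> Dunit hmin z; set D := invmx (C *m B).
have [Q QE] : exists Q, Q = B *m D *m C by exists (B *m D *m C).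
rewrite -QE.
move=> /eigenvalueP[v]; rewrite map_mxB !map_mxM map_mxB map_mx1.
set A' := map_mx _ A; set Q' := map_mx _ Q => vF v0.
have QB : Q *m B = B by rewrite QE -!mulmxA mulVmx// mulmx1.
have QQ : Q *m Q = Q by rewrite {2}QE !mulmxA QB.
have QQ' : Q' *m Q' = Q' by rewrite -map_mxM QQ.
have PQ : (1%:M - Q') *m Q' = 0 by rewrite mulmxBl mul1mx QQ' subrr.
have vQ : - (v *m Q') = z *: (v *m Q').
  rewrite scalemxAl -vF -[RHS]mulmxA mulmxBl QQ' -[_ *m _ *m Q']mulmxA PQ.
  by rewrite mulmx0 sub0r mulmxN.
have [->|zN1] := eqVneq z (-1); first by rewrite /= oppr_lt0 ltr01.
have vQ0 : v *m Q' = 0.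
  apply/eqP; have /eqP := vQ; rewrite eq_sym -subr_eq0 opprK -[X in _ + X]scale1r -scalerDl.
  by rewrite scaler_eq0 addr_eq0 (negPf zN1).
have vB0 : v *m map_mx (real_complex R) B = 0.
  by rewrite -QB map_mxM mulmxA vQ0 mul0mx.
apply: hmin; rewrite /root horner_system_poly; apply/det0P.
exists (row_mx v (- (v *m A' *m map_mx (real_complex R) (B *m D)))).
  by apply: contra v0; rewrite row_mx_eq0 => /andP[].
rewrite mul_row_block mulmx0 addr0 vB0 mulNmx -[X in _ - X]mulmxA -map_mxM -QE -/Q'.
have vP : v *m (1%:M - Q') = v by rewrite mulmxBr mulmx1 vQ0 subr0.
have -> : v *m (A' - z%:M) = v *m A' *m Q'.
  rewrite mulmxBr mul_mx_scalar -vF mulmxBr vQ0 subr0 !mulmxA vP.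
  by rewrite mulmxBr mulmx1 subKr.
by rewrite subrr row_mx0.
Qed.

Lemma pos_def_unitmx (R : realType) m (D : 'M[R]_m.+1) :
  pos_def (D^T + D) -> D \in unitmx.
Proof.
move=> pD; rewrite unitmxE unitfE; apply/negP => /det0P[v v0 vD].
have := pD v^T; rewrite trmx_eq0 => /(_ v0).
by rewrite trmxK mulmxDr vD addr0 -mulmxA -trmx_mul vD trmx0 mulmx0 mxE ltxx.
Qed.

(** * The maximum norm and expc near zero *)

(** Needed for absolutely convergent series of matrices to converge. *)
HB.instance Definition _ (R : realType) m n := Complete.on 'M[R]_(m, n).

Section max_norm.
Context {R : realType}.

Lemma mx_norm_entry m n (A : 'M[R]_(m, n)) i j : `|A i j| <= `|A|.
Proof.
rewrite [leRHS]/Num.norm /= mx_normrE; apply/bigmax_geP; right => /=.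
by exists (i, j).
Qed.

Lemma mx_norm_le m n (A : 'M[R]_(m, n)) (r : R) : 0 <= r ->
  (forall i j, `|A i j| <= r) -> `|A| <= r.
Proof.
move=> r0 Ar; rewrite [leLHS]/Num.norm /= mx_normrE; apply/bigmax_leP.
by split => // -[i j] _; exact: Ar.
Qed.

Lemma mx_norm_mul m n p (A : 'M[R]_(m, n)) (B : 'M[R]_(n, p)) :
  `|A *m B| <= n%:R * `|A| * `|B|.
Proof.
apply: mx_norm_le => [|i j]; first by rewrite !mulr_ge0.
rewrite mxE (le_trans (ler_norm_sum _ _ _))//.
apply: (@le_trans _ _ (\sum_(k < n) `|A| * `|B|)).
  by apply: ler_sum => k _; rewrite normrM ler_pM ?mx_norm_entry.
by rewrite sumr_const card_ord -[leLHS]mulr_natl mulrA.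
Qed.

Lemma dot_norm_le n (x y : 'cV[R]_n) : `|dot x y| <= n%:R * `|x| * `|y|.
Proof.
rewrite dotE (le_trans (ler_norm_sum _ _ _))//.
apply: (@le_trans _ _ (\sum_(k < n) `|x| * `|y|)).
  by apply: ler_sum => k _; rewrite normrM ler_pM ?mx_norm_entry.
by rewrite sumr_const card_ord -[leLHS]mulr_natl mulrA.
Qed.

Lemma norm_le_dot n (x : 'cV[R]_n) : `|x| ^+ 2 <= dot x x.
Proof.
rewrite -[leRHS]sqr_sqrtr ?dot_ge0// ler_pXn2r ?nnegrE ?sqrtr_ge0//.
apply: mx_norm_le; rewrite ?sqrtr_ge0// => i j.
rewrite -sqrtr_sqr ler_wsqrtr// dotE (bigD1 i)//= ord1 expr2 lerDl.
by rewrite sumr_ge0// => k _; rewrite -expr2 sqr_ge0.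
Qed.

Lemma mx_norm_exp n (X : 'M[R]_n.+1) j : `|X ^+ j| <= (n.+1%:R * `|X|) ^+ j.
Proof.
elim: j => [|j IH].
  rewrite !expr0; apply: mx_norm_le => // i k; rewrite mxE.
  by case: eqP; rewrite ?normr1 ?normr0.
rewrite !exprS; apply: le_trans (mx_norm_mul _ _) _.
by rewrite ler_wpM2l.
Qed.

(** The terms of the series are dominated by the powers of q = n |X|, and the
    geometric tail q + q^2 + ... is at most 2 q when q <= 1/2. *)
Lemma expc_near1 n (X : 'M[R]_n.+1) : n.+1%:R * `|X| <= 2^-1 ->
  `|expc X - 1| <= 2 * n.+1%:R * `|X|.
Proof.
set q := n.+1%:R * `|X| => q2.
have q0 : 0 <= q by rewrite mulr_ge0.
set u := fun j : nat => (j.+1`!%:R)^-1 *: X ^+ j : 'M[R]_n.+1.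
have uq j : `|u j| <= q ^+ j.
  rewrite /u normrZ ger0_norm ?invr_ge0//.
  rewrite -[leRHS]mul1r ler_pM ?invr_ge0 ?mx_norm_exp//.
  by rewrite invf_le1 ?ltr0n ?fact_gt0// ler1n fact_gt0.
have ucvg : cvgn (series u).
  apply: normed_cvg; apply: (@series_le_cvg _ _ (geometric 1 q)).
  - by move=> j /=.
  - by move=> j /=; rewrite mul1r exprn_ge0.
  - by move=> j /=; rewrite mul1r.
  - by apply: is_cvg_geometric_series; rewrite ger0_norm// (le_lt_trans q2)// invf_lt1// ltr1n.
(* The subtracted 2 q^(N+1) is what makes the induction close. *)
have tail N : `|series u N.+1 - 1| <= 2 * q - 2 * q ^+ N.+1.
  elim: N => [|N IH].
    rewrite /series /= big_nat1 /u expr0 factS fact0 mul1n invr1 scale1r subrr normr0.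
    by rewrite expr1 subrr.
  rewrite seriesSr -addrAC (le_trans (ler_normD _ _))//.
  apply: (le_trans (lerD IH (uq _))).
  have : 0 <= q ^+ N.+1 by rewrite exprn_ge0.
  by rewrite [q ^+ N.+2]exprS; move: (q ^+ _) => Q; nra.
have : (fun N => `|series u N.+1 - 1|) @ \oo --> `|expc X - 1|.
  apply: cvg_norm; apply: cvgB; last exact: cvg_cst.
  by rewrite (@cvg_shiftS _ (series u)).
rewrite -mulrA -/q => /cvg_lim <-//; apply: limr_le.
- apply/cvg_ex; exists `|expc X - 1|; apply: cvg_norm; apply: cvgB; last exact: cvg_cst.
  by rewrite (@cvg_shiftS _ (series u)).
- near=> N; rewrite (le_trans (tail N))// gerBl mulr_ge0//.
  by rewrite exprn_ge0.
Unshelve. all: by end_near. Qed.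

End max_norm.

(** * A comparison principle on time scales *)

Section time_scale_comparison.
Context {R : realType}.
Implicit Types (T : set R) (t : R).

Lemma unbounded_above_has_inf T t : ~ has_ubound T ->
  has_inf [set s | T s /\ t < s].
Proof.
move=> Tunb; split; last by exists t => s [_ /ltW].
apply: contrapT => noS; apply: Tunb; exists t => s Ts.
by rewrite leNgt; apply/negP => ts; apply: noS; exists s.
Qed.

Lemma sigma_ge T t : ~ has_ubound T -> t <= sigma T t.
Proof.
move=> /(@unbounded_above_has_inf T t)[S0 _].
by apply: lb_le_inf => // s [_ /ltW].
Qed.

Lemma sigma_le T t s : T s -> t < s -> sigma T t <= s.
Proof. by move=> Ts ts; apply: ge_inf => //; exists t => u [_ /ltW]. Qed.

Lemma sigma_adherent T t (e : R) : ~ has_ubound T -> 0 < e ->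
  exists s, [/\ T s, t < s & s < sigma T t + e].
Proof.
move=> /(@unbounded_above_has_inf T t) S0 e0.
by have [s [Ts ts] se] := inf_adherent e0 S0; exists s.
Qed.

Lemma closed_approx T t : closed T ->
  (forall e, 0 < e -> exists2 s, T s & `|s - t| < e) -> T t.
Proof.
move=> Tcl Tt; apply: Tcl => A /nbhs_ballP[e /= e0 eA].
have [s Ts st] := Tt e e0; exists s; split => //; apply: eA.
by rewrite /ball /= distrC.
Qed.

Lemma sigma_mem T t : closed T -> ~ has_ubound T -> T (sigma T t).
Proof.
move=> Tcl Tunb; apply: closed_approx => // e e0.
have [s [Ts ts se]] := sigma_adherent t Tunb e0; exists s => //.
by rewrite ger0_norm ?subr_ge0 ?sigma_le// ltrBlDl.
Qed.

(** Comparison with B(s) = (v t0 + h) e^(- b (s - t0)). The set of times up to t1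
    at which v <= B is closed, so it contains its supremum s0. If s0 < t1, then
    the jump condition, when s0 is right-scattered, or the slope condition, when
    it is right-dense, gives a later time in that set. The slack h > 0 and
    the gap b < a make B strictly positive and strictly slower, which absorbs
    the error e of the slope condition. *)
Lemma time_scale_comparison T (v : R -> R) (a b t0 : R) :
  closed T -> ~ has_ubound T -> T t0 -> 0 < b -> b < a ->
  (forall t, T t -> t0 <= t -> 0 <= v t) ->
  (forall t, T t -> t0 <= t -> continuous_at_on T (v : R -> R^o) t) ->
  (forall t, T t -> t0 <= t -> 0 < mu T t ->
     v (sigma T t) <= (1 - a * mu T t) * v t) ->
  (forall t, T t -> t0 <= t -> mu T t = 0 -> forall e, 0 < e ->
     \forall s \near within T t^', t < s ->
       v s <= v t + (s - t) * (e - a * v t)) ->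
  forall t, T t -> t0 <= t -> v t <= v t0 * expR (- (b * (t - t0))).
Proof.
move=> Tcl Tunb Tt0 b0 ba v0 vcont vjump vdense t1 Tt1 t01.
apply/ler_addgt0Pr => h h0.
pose B s := (v t0 + h) * expR (- (b * (s - t0))).
have vh0 : 0 < v t0 + h by rewrite ltr_wpDl ?v0.
suff vB : v t1 <= B t1.
  apply: (le_trans vB); rewrite /B mulrDl lerD2l ler_piMr ?(ltW h0)//.
  by rewrite -expR0 ler_expR oppr_le0 mulr_ge0 ?(ltW b0) ?subr_ge0.
have B0 s : 0 < B s by rewrite mulr_gt0 ?expR_gt0.
have Bstep s u : B u = B s * expR (- (b * (u - s))).
  by rewrite /B -mulrA -expRD; congr (_ * expR _); ring.
have Bcont s : B @ s --> B s.
  apply: cvgMr; apply: continuous_cvg; first exact: continuous_expR.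
  by apply: cvgN; apply: cvgMr; apply: cvgB; [exact: cvg_id|exact: cvg_cst].
pose S := [set s | [/\ T s, t0 <= s, s <= t1 & v s <= B s]].
have St0 : S t0.
  by split; rewrite ?lexx// /B subrr mulr0 oppr0 expR0 mulr1 lerDl ltW.
have Sub : has_ubound S by exists t1 => s [].
have Ssup : has_sup S by split => //; exists t0.
set s0 := sup S.
have s0t1 : s0 <= t1 by apply: ge_sup; [exists t0|move=> s []].
have t0s0 : t0 <= s0 by exact: ub_le_sup.
have Ts0 : T s0.
  apply: closed_approx => // e e0.
  have [s Ss se] := sup_adherent e0 Ssup; exists s; first by case: Ss.
  by rewrite distrC ger0_norm ?subr_ge0 ?ub_le_sup// -/s0; rewrite ltrBlDr -ltrBlDl.
have Ss0 : v s0 <= B s0.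
  rewrite leNgt; apply/negP => Bv.
  have : (fun s => v s - B s : R^o) @ within T (nbhs s0) --> v s0 - B s0.
    apply: cvgB; first exact: vcont.
    exact: cvg_within_filter (Bcont s0).
  move=> /cvgr_gt/(_ 0); rewrite subr_gt0 => /(_ Bv).
  rewrite near_withinE => /nbhs_ballP[e /= e0 He].
  have [s Ss se] := sup_adherent e0 Ssup.
  have [Ts _ _ vs] := Ss.
  have s0s : s0 - s < e by rewrite ltrBlDr -ltrBlDl.
  have := He s; rewrite /ball /= ger0_norm ?subr_ge0 ?ub_le_sup//.
  by move=> /(_ s0s Ts); rewrite subr_gt0 ltNge vs.
move: s0t1; rewrite le_eqVlt => /predU1P[<-//|s0t1].
exfalso.
have Smax s : s0 < s -> T s -> s <= t1 -> v s <= B s -> False.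
  move=> s0s Ts st1 vs; have : s <= s0.
    by apply: ub_le_sup => //; split => //; rewrite (le_trans t0s0)// ltW.
  by rewrite leNgt s0s.
have mu0 : 0 <= mu T s0 by rewrite subr_ge0 sigma_ge.
move: mu0; rewrite le_eqVlt => /predU1P[mu0|mu0].
- have ab0 : 0 < (a - b) * B s0 by rewrite mulr_gt0 ?subr_gt0.
  have a0 : 0 < a by exact: lt_trans ba.
  have := vdense _ Ts0 t0s0 (esym mu0) _ ab0.
  rewrite near_withinE /dnbhs near_withinE => /nbhs_ballP[d /= d0 Hd].
  (* Within a^-1 of s0 the factor 1 - a (s - s0) is nonnegative, so v s0 may be
     replaced by B s0. *)
  have dd0 : 0 < Order.min d (Order.min a^-1 (t1 - s0)).
    by rewrite !lt_min d0 invr_gt0 a0 subr_gt0.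
  have [s [Ts s0s]] := sigma_adherent s0 Tunb dd0.
  have -> : sigma T s0 = s0 by apply/eqP; rewrite -subr_eq0; apply/eqP.
  rewrite -ltrBlDl !lt_min => /and3P[sd sa st1].
  apply: (Smax s s0s Ts); first by rewrite -(lerD2r (- s0)) ltW.
  have := Hd s; rewrite /ball /= ltr0_norm ?subr_lt0// opprB => /(_ sd).
  rewrite gt_eqF// => /(_ isT Ts s0s) /le_trans; apply.
  rewrite (Bstep s0 s); set u := s - s0 in sd sa st1 *.
  have u0 : 0 < u by rewrite subr_gt0.
  have au : a * u <= 1 by rewrite mulrC -ler_pdivlMr// div1r ltW.
  apply: (@le_trans _ _ (B s0 * (1 - b * u))).
    have : (1 - a * u) * v s0 <= (1 - a * u) * B s0.
      by rewrite ler_wpM2l// subr_ge0.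
    by move: (B s0) (v s0) => B1 v1; nra.
  rewrite ler_wpM2l ?(ltW (B0 _))//.
  exact: expR_ge1Dx.
- apply: (Smax (sigma T s0)).
  + by rewrite -subr_gt0.
  + exact: sigma_mem.
  + exact: sigma_le.
  + apply: (le_trans (vjump _ Ts0 t0s0 mu0)).
    rewrite (Bstep s0 (sigma T s0)) mulrC -/(mu T s0).
    apply: (@le_trans _ _ (v s0 * expR (- (b * mu T s0)))).
      rewrite ler_wpM2l ?v0//.
      apply: (@le_trans _ _ (1 - b * mu T s0)); last exact: expR_ge1Dx.
      by rewrite lerD2l lerN2 ler_wpM2r// ltW.
    by rewrite ler_wpM2r ?expR_ge0.
Qed.

End time_scale_comparison.

(** * The quadratic Lyapunov function of the closed loop *)

Section closed_loop_lyapunov.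
Context {R : realType}.

Lemma mulmx_bounded m n (M : 'M[R]_(m, n)) :
  exists2 c : R, 0 < c & forall x : 'cV_n, `|M *m x| <= c * `|x|.
Proof.
exists (n%:R * `|M| + 1) => [|x]; first by rewrite ltr_wpDl// mulr_ge0.
by rewrite (le_trans (mx_norm_mul _ _))// mulrDl lerDl mulr_ge0.
Qed.

Lemma dot_mulmx_bounded m n (M : 'M[R]_(m, n)) :
  exists2 c : R, 0 < c &
    forall (x : 'cV_m) (y : 'cV_n), `|dot x (M *m y)| <= c * (`|x| * `|y|).
Proof.
have [c c0 Mc] := mulmx_bounded M; exists ((m%:R + 1) * c) => [|x y].
  by rewrite mulr_gt0// ltr_wpDl.
apply: le_trans (dot_norm_le _ _) _.
have -> : (m%:R + 1) * c * (`|x| * `|y|) = (m%:R + 1) * `|x| * (c * `|y|) by ring.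
by rewrite ler_pM ?mulr_ge0// ler_wpM2r// lerDl.
Qed.

(** Here y and z stand for the norms of the output and of the zero dynamics, and
    b k y^2 is the damping that the gain provides. The only cross term not
    carrying the small factor r is 2 c y z, which is at most
    (g/4) z^2 + (4 c^2/g) y^2; a large k pays for the second part. *)
Lemma high_gain_absorption (b g c : R) : 0 < b -> 0 < g -> 0 < c ->
  exists k0 r0 : R, [/\ 0 < k0, 0 < r0 & forall k r y z : R,
    k0 <= k -> 0 <= r -> r <= r0 -> 0 <= y -> 0 <= z ->
    - (k * b * y ^+ 2) - g * z ^+ 2
      + c * (y * (y + z) + r * (y + z) ^+ 2 + z * (y + r * z))
    <= - (g / 2) * (y ^+ 2 + z ^+ 2)].
Proof.
move=> b0 g0 c0.
exists ((6 * c + 4 * c ^+ 2 / g + g / 2) / b), (Order.min 1 (g / (12 * c))).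
split.
- by rewrite divr_gt0// !addr_gt0// ?divr_gt0 ?mulr_gt0 ?exprn_gt0.
- by rewrite lt_min ltr01 divr_gt0// mulr_gt0.
move=> k r y z; rewrite ler_pdivrMr// => kb r0; rewrite le_min => /andP[r1 rg] y0 z0.
have {rg} : r * (12 * c) <= g by rewrite -ler_pdivlMr// mulr_gt0.
move=> rg; have y2 := sqr_ge0 y; have z2 := sqr_ge0 z.
have kb2 : (6 * c + 4 * c ^+ 2 / g + g / 2) * y ^+ 2 <= k * b * y ^+ 2.
  by rewrite ler_wpM2r.
have yz : 2 * c * (y * z) <= g / 4 * z ^+ 2 + 4 * c ^+ 2 / g * y ^+ 2.
  rewrite -subr_ge0.
  have -> : g / 4 * z ^+ 2 + 4 * c ^+ 2 / g * y ^+ 2 - 2 * c * (y * z) =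
    g * (z / 2 - 2 * c / g * y) ^+ 2 by field; rewrite gt_eqF.
  by rewrite mulr_ge0 ?(ltW g0)// sqr_ge0.
have ryz : c * (r * (y + z) ^+ 2) <= c * (r * (2 * (y ^+ 2 + z ^+ 2))).
  rewrite ler_wpM2l ?(ltW c0)// ler_wpM2l//.
  by have := sqr_ge0 (y - z); nra.
have ry : c * r * y ^+ 2 <= c * y ^+ 2.
  by rewrite ler_wpM2r// ler_piMr// ltW.
have cy : 0 <= c * y ^+ 2 by rewrite mulr_ge0 ?(ltW c0).
have rz : 12 * c * r * z ^+ 2 <= g * z ^+ 2.
  by rewrite ler_wpM2r// mulrC.
have -> : c * (y * (y + z) + r * (y + z) ^+ 2 + z * (y + r * z)) =
  c * y ^+ 2 + 2 * c * (y * z) + c * (r * (y + z) ^+ 2) + c * r * z ^+ 2 by ring.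
move: cy kb2 yz ryz ry rz; move: (4 * c ^+ 2 / g) => q.
move: (k * b * y ^+ 2) (y * z) => X Y.
lra.
Qed.

(** Replacing expc(rA) by the identity costs r |A x| + r k |B y|, up to a
    constant. As r k is bounded, the second part is of the order of |y|: it does
    not vanish with r, but it concerns only the output, which the gain damps. *)
Lemma sampling_error n m (A : 'M[R]_n.+1) (B : 'M[R]_(n.+1, m)) (c0 : R) :
  0 < c0 -> exists r1 c : R, [/\ 0 < r1, 0 < c & forall (k r : R) (x : 'cV_n.+1) (y : 'cV_m),
    0 <= k -> 0 <= r -> r <= r1 -> r * k <= c0 ->
    `|(expc (r *: A) - 1) *m (A *m x - k *: (B *m y))| <= c * (`|y| + r * `|x|)].
Proof.
move=> c00; have [a a0 Aa] := mulmx_bounded A; have [b b0 Bb] := mulmx_bounded B.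
pose N : R := n.+1%:R; pose d := N * (2 * N * `|A|) + 1.
have N0 : 0 < N by rewrite /N ltr0n.
have d0 : 0 < d by rewrite ltr_wpDl// !mulr_ge0// ltW.
exists (2 * N * `|A| + 1)^-1, (d * (a + b * c0)); split.
- by rewrite invr_gt0 ltr_wpDl// !mulr_ge0// ltW.
- by rewrite mulr_gt0// addr_gt0// mulr_gt0.
move=> k r x y k0 r0 rr1 rk.
have A0 : 0 <= `|A| by [].
have Er : `|expc (r *: A) - 1| <= 2 * N * (r * `|A|).
  have rA : `|r *: A| = r * `|A| by rewrite normrZ ger0_norm.
  rewrite -rA; apply: expc_near1; rewrite rA.
  have : r * (2 * N * `|A| + 1) <= 1.
    by rewrite -ler_pdivlMr ?div1r// ltr_wpDl// !mulr_ge0// ltW.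
  rewrite -/N; lra.
have inner : `|A *m x - k *: (B *m y)| <= a * `|x| + k * (b * `|y|).
  rewrite (le_trans (ler_normB _ _))// lerD//.
  by rewrite normrZ ger0_norm// ler_wpM2l.
apply: (le_trans (mx_norm_mul _ _)); rewrite -/N.
apply: (@le_trans _ _ (N * (2 * N * (r * `|A|)) * (a * `|x| + k * (b * `|y|)))).
  by rewrite ler_pM ?mulr_ge0 ?(ltW N0)// ler_wpM2l ?(ltW N0).
have -> : N * (2 * N * (r * `|A|)) * (a * `|x| + k * (b * `|y|)) =
  N * (2 * N * `|A|) * (a * (r * `|x|) + b * (r * k) * `|y|) by ring.
rewrite -[leRHS]mulrA; apply: ler_pM.
- by rewrite !mulr_ge0// ltW.
- by rewrite addr_ge0// !mulr_ge0// ltW.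
- by rewrite lerDl.
have x0 : 0 <= r * `|x| by rewrite mulr_ge0.
have y0 : 0 <= `|y| by [].
have by0 : 0 <= b * `|y| by rewrite mulr_ge0// ltW.
have h1 : b * (r * k) * `|y| <= b * c0 * `|y|.
  by rewrite -mulrA mulrCA -[leRHS]mulrA [leRHS]mulrCA ler_wpM2r.
have h2 : 0 <= a * `|y| by rewrite mulr_ge0// ltW.
have h3 : 0 <= b * c0 * (r * `|x|) by rewrite !mulr_ge0// ltW.
rewrite mulrDl !mulrDr.
lra.
Qed.

(** The increment of |y|^2 under the velocity e - k D y. The step length enters
    through r k^2 |D y|^2, which the hypothesis on r k lmax turns into a part of
    the damping k lmin |y|^2, leaving k b |y|^2. *)
Lemma output_decrement m (D : 'M[R]_m) (lmin lmax b c0 : R) :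
  (forall y, lmin * dot y y <= dot y ((D + D^T) *m y)) ->
  (forall y, dot (D *m y) (D *m y) <= lmax * dot y y) ->
  0 <= b -> 0 < c0 ->
  exists2 c : R, 0 < c & forall (k r : R) (y e : 'cV_m),
    0 <= k -> 0 <= r -> r * k <= c0 -> r * k * lmax <= lmin - b ->
    2 * dot y (e - k *: (D *m y)) + r * dot (e - k *: (D *m y)) (e - k *: (D *m y))
    <= - (k * b * `|y| ^+ 2) + c * (`|y| * `|e| + r * `|e| ^+ 2).
Proof.
move=> hmin hmax b0 c00.
have [c1 c10 H1] := @dot_mulmx_bounded m m 1%:M.
have [c2 c20 H2] := @dot_mulmx_bounded m m D.
have dotb (u w : 'cV_m) : `|dot u w| <= c1 * (`|u| * `|w|) by have := H1 u w; rewrite mul1mx.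
exists (2 * c1 + 2 * c0 * c2) => [|k r y e k0 r0 rk rkl].
  by rewrite addr_gt0// !mulr_gt0.
have -> : 2 * dot y (e - k *: (D *m y)) +
    r * dot (e - k *: (D *m y)) (e - k *: (D *m y)) =
  - (k * dot y ((D + D^T) *m y)) + r * k * (k * dot (D *m y) (D *m y)) +
  (2 * dot y e - 2 * (r * k) * dot e (D *m y) + r * dot e e).
  have -> : dot y ((D + D^T) *m y) = 2 * dot y (D *m y).
    by rewrite mulmxDl dotDr [X in _ + X]dot_mulmx trmxK [X in _ + X]dotC; ring.
  rewrite -scaleNr !dotDr !dotDl !dotZr !dotZl [dot (D *m y) e]dotC; ring.
have y2 := norm_le_dot y.
have ydot := dot_ge0 y.
have main : - (k * dot y ((D + D^T) *m y)) + r * k * (k * dot (D *m y) (D *m y))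
    <= - (k * b * `|y| ^+ 2).
  have e1 : k * (lmin * dot y y) <= k * dot y ((D + D^T) *m y).
    by rewrite ler_wpM2l.
  have e2 : r * k * (k * dot (D *m y) (D *m y)) <= r * k * (k * (lmax * dot y y)).
    by rewrite ler_wpM2l ?mulr_ge0// ler_wpM2l.
  have e3 : r * k * lmax * (k * dot y y) <= (lmin - b) * (k * dot y y).
    by rewrite ler_wpM2r// mulr_ge0.
  have e4 : k * b * `|y| ^+ 2 <= k * b * dot y y by rewrite ler_wpM2l ?mulr_ge0.
  lra.
have f1 : dot y e <= c1 * (`|y| * `|e|) by rewrite (le_trans (ler_norm _)).
have f2 : - (r * k * dot e (D *m y)) <= c0 * (c2 * (`|y| * `|e|)).
  rewrite -mulrN; apply: (@le_trans _ _ (r * k * (c2 * (`|e| * `|y|)))).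
    rewrite ler_wpM2l ?mulr_ge0// (le_trans (ler_norm _))// normrN.
    exact: H2.
  by rewrite [`|e| * _]mulrC ler_wpM2r// !mulr_ge0// ltW.
have f3 : r * dot e e <= c1 * (r * `|e| ^+ 2).
  rewrite [leRHS]mulrCA; apply: ler_wpM2l => //.
  by apply: le_trans (ler_norm _) _; rewrite expr2; exact: dotb.
have f4 : 0 <= c0 * c2 * (r * `|e| ^+ 2).
  by apply: mulr_ge0; [rewrite mulr_ge0// ltW | rewrite mulr_ge0// sqr_ge0].
have f5 : 0 <= c1 * (r * `|e| ^+ 2).
  by apply: mulr_ge0; [exact: ltW | rewrite mulr_ge0// sqr_ge0].
lra.
Qed.

(** The increment of z^T P z under the velocity F z + w; half of the decay 2 g |z|^2
    provided by P is given away. *)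
Lemma internal_decrement n (P F : 'M[R]_n) (g : R) : 0 < g ->
  (forall z, dot z (P *m (F *m z)) <= - g * dot z z) ->
  exists2 c : R, 0 < c & forall (r : R) (z w : 'cV_n), 0 <= r ->
    2 * dot z (P *m (F *m z + w)) + r * dot (F *m z + w) (P *m (F *m z + w))
    <= - (g * `|z| ^+ 2) + c * (`|z| * `|w| + r * `|F *m z + w| ^+ 2).
Proof.
move=> g0 hF; have [c c0 Hc] := dot_mulmx_bounded P.
exists (2 * c) => [|r z w r0]; first by rewrite mulr_gt0.
set u := F *m z + w.
have e1 : dot z (P *m u) = dot z (P *m (F *m z)) + dot z (P *m w).
  by rewrite mulmxDr dotDr.
have e2 : dot z (P *m (F *m z)) <= - (g * `|z| ^+ 2).
  apply: (le_trans (hF z)).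
  by rewrite mulNr lerN2 ler_wpM2l ?(ltW g0)// norm_le_dot.
have e3 : dot z (P *m w) <= c * (`|z| * `|w|) by rewrite (le_trans (ler_norm _)).
have e4 : r * dot u (P *m u) <= c * (r * `|u| ^+ 2).
  rewrite [leRHS]mulrCA; apply: ler_wpM2l => //.
  by apply: le_trans (ler_norm _) _; rewrite expr2; exact: Hc.
have e5 : 0 <= c * (r * `|u| ^+ 2).
  by apply: mulr_ge0; [exact: ltW | rewrite mulr_ge0// sqr_ge0].
have e6 : 0 <= g * `|z| ^+ 2 by apply: mulr_ge0; [exact: ltW | exact: sqr_ge0].
rewrite e1; lra.
Qed.

Lemma dot_tr_mulmx m n p (M : 'M[R]_(m, n)) (N : 'M[R]_(m, p)) x y :
  dot x (M^T *m (N *m y)) = dot (M *m x) (N *m y).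
Proof. by rewrite dot_mulmx trmxK. Qed.

Lemma lambda_max_gt0 m (D : 'M[R]_m.+1) : D \in unitmx ->
  0 < lambda_max (D^T *m D).
Proof.
move=> Du; pose x : 'cV[R]_m.+1 := const_mx 1.
have x0 : x != 0.
  by apply/eqP => /matrixP/(_ 0 0); rewrite !mxE => /eqP; rewrite oner_eq0.
have Dx0 : D *m x != 0.
  by apply: contra x0 => /eqP Dx; rewrite -[x](mulKmx Du) Dx mulmx0.
have := @lambda_max_ge _ _ (D^T *m D) x; rewrite trmx_mul trmxK => /(_ erefl).
rewrite -mulmxA dot_tr_mulmx => /(lt_le_trans (dot_gt0 Dx0)).
by rewrite pmulr_lgt0// dot_gt0.
Qed.

Lemma dot_le_norm n (x : 'cV[R]_n) : dot x x <= n%:R * `|x| ^+ 2.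
Proof. by rewrite expr2 mulrA (le_trans (ler_norm _))// dot_norm_le. Qed.

(** Writing f for the velocity, C f = e - k D y with e = O(|y| + |z|), and
    Pi f = F z + w with w = O(|y| + r |z|): the gain disappears from the second
    equation because Pi B = 0. *)
Lemma closed_loop_quadratic n m (A : 'M[R]_n.+1) (B : 'M[R]_(n.+1, m.+1))
    (C : 'M[R]_(m.+1, n.+1)) (eps : R) :
  minimum_phase A B C -> pos_def ((C *m B)^T + C *m B) -> 0 < eps ->
  exists (Q : 'M[R]_n.+1) (c a k0 r0 : R), [/\ 0 < c, 0 < a, 0 < k0, 0 < r0 &
   [/\ Q^T = Q, forall x : 'cV_n.+1, c * dot x x <= dot x (Q *m x) &
    forall (k r : R) (x f : 'cV_n.+1), k0 <= k -> 0 <= r -> r <= r0 ->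
    r <= k^-1 * (lambda_min (C *m B + (C *m B)^T)
                   / lambda_max ((C *m B)^T *m (C *m B)) - eps) ->
    f = expc (r *: A) *m (A - k *: (B *m C)) *m x ->
    2 * dot x (Q *m f) + r * dot f (Q *m f) <= - a * dot x (Q *m x)]].
Proof.
move=> hmin hpos eps0.
have Du := pos_def_unitmx hpos.
set D := C *m B in hpos Du *.
set lmin := lambda_min _; set lmax := lambda_max _.
have lmax0 : 0 < lmax by exact: lambda_max_gt0.
pose G := B *m invmx D.
pose Pi := 1%:M - G *m C.
have PiB : Pi *m B = 0.
  by rewrite /Pi /G mulmxBl mul1mx -[_ *m C *m B]mulmxA -/D mulmxKV// subrr.
have CPi : C *m Pi = 0.
  by rewrite /Pi /G mulmxBr mulmx1 !mulmxA -/D mulmxV// mul1mx subrr.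
have PiPi : Pi *m Pi = Pi.
  by rewrite {1}/Pi mulmxBl mul1mx -mulmxA CPi mulmx0 subr0.
have [P [p [g [Psym p0 g0 Pp PF]]]] := lyapunov (minimum_phase_hurwitz Du hmin).
set F := _ - _ in PF.
have FPi (z : 'cV_n.+1) : F *m (Pi *m z) = Pi *m (A *m (Pi *m z)).
  by rewrite /F -/G -/Pi mulmxBl -!mulmxA [C *m (Pi *m z)]mulmxA CPi mul0mx
    !mulmx0 subr0 [Pi *m (Pi *m z)]mulmxA PiPi.
(* An upper bound of r k, made positive whatever the sign of q. *)
pose q := lmin / lmax - eps; pose c0 := `|q| + 1.
have c00 : 0 < c0 by rewrite ltr_wpDl.
have [r1 [ch [r10 ch0 Hh]]] := sampling_error A B c00.
have lminD y : lmin * dot y y <= dot y ((D + D^T) *m y).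
  by apply: lambda_min_le; rewrite linearD /= trmxK addrC.
have lmaxD y : dot (D *m y) (D *m y) <= lmax * dot y y.
  rewrite -dot_tr_mulmx mulmxA; apply: lambda_max_ge.
  by rewrite trmx_mul trmxK.
have b0 : 0 <= eps * lmax by rewrite mulr_ge0 ?ltW.
have [co co0 Ho] := output_decrement lminD lmaxD b0 c00.
have [ci ci0 Hi] := internal_decrement g0 PF.
have [nG nG0 HG] := mulmx_bounded G.
have [nCA nCA0 HCA] := mulmx_bounded (C *m A).
have [nC nC0 HC] := mulmx_bounded C.
have [nPAG nPAG0 HPAG] := mulmx_bounded (Pi *m A *m G).
have [nPi nPi0 HPi] := mulmx_bounded Pi.
have [nF nF0 HF] := mulmx_bounded F.
have [nP nP0 HP] := dot_mulmx_bounded P.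
have split (x : 'cV_n.+1) : x = Pi *m x + G *m (C *m x).
  by rewrite mulmxBl mul1mx -mulmxA subrK.
have xbound (x : 'cV_n.+1) : `|x| <= `|Pi *m x| + nG * `|C *m x|.
  apply: (@le_trans _ _ `|Pi *m x + G *m (C *m x)|); first by rewrite -split.
  by apply: le_trans (ler_normD _ _) _; rewrite lerD2l.
(* The norms of h, e, w and F z + w defined below are at most cx, ce, cw and cf
   times |y| + r |z| or |y| + |z|. *)
pose cx := ch * (1 + nG).
pose ce := nCA * (1 + nG) + nC * cx.
pose cw := nPAG + nPi * cx.
pose cf := nF + cw.
have cx0 : 0 < cx by apply: mulr_gt0 => //; exact: addr_gt0.
have ce0 : 0 < ce.
  by apply: addr_gt0; apply: mulr_gt0 => //; exact: addr_gt0.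
have cw0 : 0 < cw by apply: addr_gt0 => //; exact: mulr_gt0.
have cf0 : 0 < cf by exact: addr_gt0.
pose K := co * (ce + ce ^+ 2) + ci * (cw + cf ^+ 2).
have K0 : 0 < K.
  by apply: addr_gt0; apply: mulr_gt0 => //; apply: addr_gt0 => //; exact: exprn_gt0.
have bpos : 0 < eps * lmax by rewrite mulr_gt0.
have [k0 [r0 [k00 r00 Habs]]] := high_gain_absorption bpos g0 K0.
pose V := C^T *m C + Pi^T *m (P *m Pi).
have VE x u : dot x (V *m u) = dot (C *m x) (C *m u) + dot (Pi *m x) (P *m (Pi *m u)).
  by rewrite mulmxDl dotDr -!mulmxA !dot_tr_mulmx.
pose c8 := m.+1%:R + nP.
have c80 : 0 < c8 by rewrite addr_gt0.
have Vup x : dot x (V *m x) <= c8 * (`|C *m x| ^+ 2 + `|Pi *m x| ^+ 2).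
  rewrite VE; set y := C *m x; set z := Pi *m x.
  have h1 := dot_le_norm y.
  have h2 : dot z (P *m z) <= nP * `|z| ^+ 2 by rewrite expr2 (le_trans (ler_norm _)).
  have h3 : 0 <= nP * `|y| ^+ 2 by rewrite mulr_ge0 ?sqr_ge0// ltW.
  have h4 : 0 <= m.+1%:R * `|z| ^+ 2 by rewrite mulr_ge0 ?sqr_ge0.
  rewrite /c8; move: (m.+1%:R) h1 h4 => M h1 h4; lra.
pose c9 := n.+1%:R * (2 * (1 + nG ^+ 2)).
have c90 : 0 < c9 by rewrite mulr_gt0// mulr_gt0// addr_gt0// exprn_gt0.
have Vlow x : Order.min 1 p / c9 * dot x x <= dot x (V *m x).
  have pm0 : 0 < Order.min 1 p by rewrite lt_min ltr01.
  rewrite mulrAC ler_pdivrMr// VE.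
  set y := C *m x; set z := Pi *m x.
  have h1 : dot x x <= c9 * (dot y y + dot z z).
    apply: (le_trans (dot_le_norm x)); rewrite /c9 -mulrA ler_wpM2l//.
    have hx := xbound x; rewrite -/y -/z in hx.
    apply: (@le_trans _ _ ((`|z| + nG * `|y|) ^+ 2)).
      by rewrite ler_pXn2r ?nnegrE ?addr_ge0 ?mulr_ge0// ltW.
    apply: (@le_trans _ _ (2 * (1 + nG ^+ 2) * (`|y| ^+ 2 + `|z| ^+ 2))).
      have s1 := sqr_ge0 (`|z| - nG * `|y|).
      have s2 := sqr_ge0 `|y|; have s3 : 0 <= nG ^+ 2 * `|z| ^+ 2.
        by rewrite mulr_ge0 ?sqr_ge0.
      lra.
    rewrite ler_wpM2l// ?lerD ?norm_le_dot//.
    by rewrite mulr_ge0// addr_ge0// sqr_ge0.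
  have h2 : Order.min 1 p * (dot y y + dot z z) <= dot y y + dot z (P *m z).
    have y0 := dot_ge0 y; have z0 := dot_ge0 z.
    rewrite mulrDr lerD//.
      by rewrite ler_piMl// ge_min lexx.
    by apply: le_trans (Pp z); rewrite ler_wpM2r// ge_min lexx orbT.
  apply: (@le_trans _ _ (Order.min 1 p * (c9 * (dot y y + dot z z)))).
    by rewrite ler_wpM2l// ltW.
  by rewrite mulrCA mulrC ler_wpM2r// ltW.
exists V, (Order.min 1 p / c9), (g / 2 / c8), k0, (Order.min (Order.min 1 r1) r0).
split.
- by rewrite divr_gt0// lt_min ltr01.
- by rewrite !divr_gt0.
- by [].
- by rewrite !lt_min ltr01 r10 r00.
split => //.
  by rewrite /V linearD /= !trmx_mul !trmxK Psym mulmxA.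
move=> k r x f kk0 rge0 rmin rk fdef.
move: rmin; rewrite !le_min => /andP[/andP[rle1 rr1] rr0].
have kpos : 0 < k by exact: lt_le_trans kk0.
have kge0 := ltW kpos.
have {}rk : r * k <= q by rewrite -ler_pdivlMr// mulrC.
have rkc0 : r * k <= c0.
  by rewrite (le_trans rk)// (le_trans (ler_norm _))// lerDl.
have rkl : r * k * lmax <= lmin - eps * lmax.
  apply: (@le_trans _ _ (q * lmax)); first by rewrite ler_wpM2r// ltW.
  by rewrite mulrBl divfK// gt_eqF.
pose y := C *m x; pose z := Pi *m x.
pose h := (expc (r *: A) - 1) *m (A *m x - k *: (B *m y)).
have fE : f = A *m x - k *: (B *m y) + h.
  rewrite fdef /h [in RHS]mulmxBl [1 *m _]mul1mx [RHS]addrC subrK -mulmxA.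
  congr (_ *m _).
  by rewrite mulmxBl -scalemxAl -mulmxA.
pose e := C *m A *m x + C *m h.
pose w := Pi *m A *m G *m y + Pi *m h.
have Cf : C *m f = e - k *: (D *m y).
  by rewrite fE /e mulmxDr mulmxBr -scalemxAr !mulmxA addrAC.
have Pf : Pi *m f = F *m z + w.
  rewrite fE FPi /w mulmxDr mulmxBr -scalemxAr [Pi *m (B *m y)]mulmxA PiB.
  rewrite mul0mx scaler0 subr0 addrA; congr (_ + _).
  by rewrite {1}[x]split !mulmxDr -!mulmxA.
have y0 : 0 <= `|y| by []. have z0 : 0 <= `|z| by [].
have ry : 0 <= r * `|y| by rewrite mulr_ge0.
have rz : 0 <= r * `|z| by rewrite mulr_ge0.
have ry1 : r * `|y| <= `|y| by rewrite ler_piMl.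
have rz1 : r * `|z| <= `|z| by rewrite ler_piMl.
have hx : `|x| <= `|z| + nG * `|y| by exact: xbound.
have hh : `|h| <= cx * (`|y| + r * `|z|).
  apply: (le_trans (Hh _ _ _ _ kge0 rge0 rr1 rkc0)).
  rewrite /cx -mulrA ler_wpM2l ?(ltW ch0)//.
  have : r * `|x| <= r * (`|z| + nG * `|y|) by rewrite ler_wpM2l.
  have : nG * (r * `|y|) <= nG * `|y| by rewrite ler_wpM2l// ltW.
  have : 0 <= nG * (r * `|z|) by rewrite mulr_ge0// ltW.
  lra.
have he : `|e| <= ce * (`|y| + `|z|).
  rewrite (le_trans (ler_normD _ _))// /ce mulrDl lerD//.
    apply: (le_trans (HCA _)); rewrite -mulrA ler_wpM2l ?(ltW nCA0)//.
    have : 0 <= nG * `|z| by rewrite mulr_ge0// ltW.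
    lra.
  apply: (le_trans (HC _)); rewrite -mulrA ler_wpM2l ?(ltW nC0)//.
  by apply: (le_trans hh); rewrite ler_wpM2l ?(ltW cx0)// lerD2l.
have hw : `|w| <= cw * (`|y| + r * `|z|).
  rewrite (le_trans (ler_normD _ _))// /cw mulrDl lerD//.
    by apply: (le_trans (HPAG _)); rewrite ler_wpM2l ?(ltW nPAG0)// lerDl.
  by apply: (le_trans (HPi _)); rewrite -mulrA ler_wpM2l ?(ltW nPi0).
have hu : `|F *m z + w| <= cf * (`|y| + `|z|).
  rewrite (le_trans (ler_normD _ _))// /cf mulrDl lerD//.
    by apply: (le_trans (HF _)); rewrite ler_wpM2l ?(ltW nF0)// lerDr.
  by apply: (le_trans hw); rewrite ler_wpM2l ?(ltW cw0)// lerD2l.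
have Iout := Ho k r y e kge0 rge0 rkc0 rkl.
have Iin := Hi r z w rge0.
have Iabs := Habs k r `|y| `|z| kk0 rge0 rr0 y0 z0.
have Vx := Vup x; rewrite -/y -/z in Vx.
rewrite !VE Cf Pf -/y -/z.
set s := `|y| + `|z| in he hu Iabs.
have s0 : 0 <= s by rewrite addr_ge0.
set t := `|y| + r * `|z| in hw Iabs.
have t0 : 0 <= t by rewrite addr_ge0.
have b1 : `|y| * `|e| <= ce * (`|y| * s) by rewrite mulrCA ler_wpM2l.
have b2 : r * `|e| ^+ 2 <= ce ^+ 2 * (r * s ^+ 2).
  rewrite [leRHS]mulrCA -exprMn; apply: ler_wpM2l => //.
  by rewrite ler_pXn2r ?nnegrE// mulr_ge0// ltW.
have b3 : `|z| * `|w| <= cw * (`|z| * t) by rewrite mulrCA ler_wpM2l.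
have b4 : r * `|F *m z + w| ^+ 2 <= cf ^+ 2 * (r * s ^+ 2).
  rewrite [leRHS]mulrCA -exprMn; apply: ler_wpM2l => //.
  by rewrite ler_pXn2r ?nnegrE// mulr_ge0// ltW.
have ys : 0 <= `|y| * s by rewrite mulr_ge0.
have zt : 0 <= `|z| * t by rewrite mulr_ge0.
have rs : 0 <= r * s ^+ 2 by rewrite mulr_ge0// sqr_ge0.
have total : co * (`|y| * `|e| + r * `|e| ^+ 2) +
    ci * (`|z| * `|w| + r * `|F *m z + w| ^+ 2)
    <= K * (`|y| * s + r * s ^+ 2 + `|z| * t).
  set S := `|y| * s + r * s ^+ 2 + `|z| * t.
  have S0 : 0 <= S by rewrite !addr_ge0.
  rewrite /K mulrDl -!mulrA lerD// ler_wpM2l ?(ltW co0) ?(ltW ci0)//.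
    rewrite mulrDl lerD//.
      by apply: (le_trans b1); rewrite ler_wpM2l ?(ltW ce0)// /S -addrA lerDl addr_ge0.
    apply: (le_trans b2); rewrite ler_wpM2l ?sqr_ge0// /S.
    by rewrite -addrA addrCA lerDl addr_ge0.
  rewrite mulrDl lerD//.
    by apply: (le_trans b3); rewrite ler_wpM2l ?(ltW cw0)// /S lerDr addr_ge0.
  apply: (le_trans b4); rewrite ler_wpM2l ?sqr_ge0// /S.
  by rewrite -addrA addrCA lerDl addr_ge0.
have final : - (g / 2) * (`|y| ^+ 2 + `|z| ^+ 2) <= - (g / 2 / c8) * dot x (V *m x).
  rewrite !mulNr lerN2 -[leLHS]mulrA ler_wpM2l ?divr_ge0 ?(ltW g0)//.
  by rewrite ler_pdivrMl.
rewrite -VE; apply: le_trans final; apply: le_trans Iabs.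
move: total Iout Iin; rewrite [k * (eps * lmax)]mulrC; clear; lra.
Qed.

End closed_loop_lyapunov.

(** * From the quadratic form to the trajectories *)

Section trajectories.
Context {R : realType}.

Lemma dot_mulmx_cvg (S : Type) (F : set_system S) {FF : Filter F} n
    (Q : 'M[R]_n) (f g : S -> 'cV[R]_n) (x y : 'cV[R]_n) :
  f @ F --> x -> g @ F --> y ->
  (fun s => dot (f s) (Q *m g s) : R^o) @ F --> (dot x (Q *m y) : R^o).
Proof.
move=> fx gy.
have entry (h : S -> 'cV[R]_n) (z : 'cV[R]_n) i : h @ F --> z ->
    (fun s => h s i 0 : R^o) @ F --> (z i 0 : R^o).
  move=> hz; apply: (@continuous_cvg _ _ _ F FF h (fun M : 'cV[R]_n => M i 0)) hz.
  exact: coord_continuous.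
have sum (I : finType) (u : I -> S -> R^o) (l : I -> R^o) :
    (forall i, u i @ F --> l i) ->
    (fun s => \sum_i u i s : R^o) @ F --> (\sum_i l i : R^o).
  by move=> ul; apply: cvg_big => //; exact: add_continuous.
rewrite dotE.
have -> : (fun s => dot (f s) (Q *m g s)) =
    (fun s => \sum_i f s i 0 * (Q *m g s) i 0).
  by apply/funext => s; rewrite dotE.
apply: (sum) => i; apply: cvgM; first exact: entry.
rewrite mxE.
have -> : (fun s => (Q *m g s) i 0) = (fun s => \sum_j Q i j * g s j 0).
  by apply/funext => s; rewrite mxE.
by apply: sum => j; apply: cvgM; [exact: cvg_cst|exact: entry].
Qed.

Lemma quadratic_step n (Q : 'M[R]_n) (x u : 'cV[R]_n) (h : R) : Q^T = Q ->
  dot (x + h *: u) (Q *m (x + h *: u)) =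
  dot x (Q *m x) + h * (2 * dot x (Q *m u) + h * dot u (Q *m u)).
Proof.
move=> Qsym; rewrite mulmxDr -scalemxAr !dotDl !dotDr !dotZl !dotZr.
have -> : dot u (Q *m x) = dot x (Q *m u) by rewrite dot_mulmx Qsym dotC.
ring.
Qed.

Lemma mu_nonneg_part (T : set R) t : 0 <= t -> mu (T `&` [set s | 0 <= s]) t = mu T t.
Proof.
move=> t0; rewrite /mu /sigma; congr (inf _ - _).
apply/seteqP; split => s /=; first by move=> [[Ts _] ts].
by move=> [Ts ts]; split => //; split => //; rewrite (le_trans t0)// ltW.
Qed.

(** Supplies the initial time after which the gain is large, and with it the
    graininess small. *)
Lemma class_K_eventually_ge (T : set R) k (M : R) : ~ has_ubound T -> class_K T k ->
  exists t0, [/\ T t0, 0 <= t0 & forall t, T t -> t0 <= t -> M <= k t].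
Proof.
move=> Tunb [_ _ _ /cvgryPge/(_ M)]; rewrite near_withinE => -[N [_ HN]].
have [s [Ts Ns]] : exists s, T s /\ Order.max N 0 < s.
  apply: contrapT => H; apply: Tunb; exists (Order.max N 0) => s Ts.
  by rewrite leNgt; apply/negP => Ns; apply: H; exists s.
move: Ns; rewrite gt_max => /andP[Ns s0]; exists s; split => //; first exact: ltW.
by move=> t Tt st; apply: HN => //=; exact: lt_le_trans st.
Qed.

(** At a right-dense point t, x s = x t + (s - t) q s where the difference
    quotient q tends to f t, so [quadratic_step] covers both kinds of points:
    the slope of the form tends to the value with mu = 0. *)
Lemma quadratic_decay n (T : set R) (Q : 'M[R]_n) (x f : R -> 'cV[R]_n)
    (a t0 : R) : Q^T = Q -> (forall y, 0 <= dot y (Q *m y)) ->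
  closed T -> ~ has_ubound T -> T t0 -> 0 < a ->
  (forall t, T t -> t0 <= t ->
     continuous_at_on T x t /\ is_delta_derive T x t (f t)) ->
  (forall t, T t -> t0 <= t ->
     2 * dot (x t) (Q *m f t) + mu T t * dot (f t) (Q *m f t)
     <= - a * dot (x t) (Q *m x t)) ->
  forall t, T t -> t0 <= t ->
    dot (x t) (Q *m x t)
    <= dot (x t0) (Q *m x t0) * expR (- (a / 2 * (t - t0))).
Proof.
move=> Qsym Q0 Tcl Tunb Tt0 a0 xf decr.
apply: (@time_scale_comparison _ T (fun t => dot (x t) (Q *m x t)) a (a / 2)) => //.
- by rewrite divr_gt0.
- by rewrite ltr_pdivrMr// mulr_natr mulr2n ltrDl.
- move=> t Tt t0t; have [xc _] := xf t Tt t0t.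
  exact: dot_mulmx_cvg.
- move=> t Tt t0t mu0; have [_ [/(_ mu0) ft _]] := xf t Tt t0t.
  have -> : x (sigma T t) = x t + mu T t *: f t.
    by rewrite ft scalerA divff ?gt_eqF// scale1r addrC subrK.
  rewrite quadratic_step// [leRHS]mulrBl mul1r lerD2l.
  have := decr t Tt t0t; rewrite -(ler_pM2l mu0) => /le_trans; apply.
  by rewrite mulrA mulrN [mu T t * a]mulrC mulNr.
- move=> t Tt t0t mu0 e e0; have [_ [_ /(_ mu0) ft]] := xf t Tt t0t.
  pose q s := (t - s)^-1 *: (x t - x s).
  have st : (fun s : R => s - t : R^o) @ within T t^' --> (0 : R^o).
    rewrite -(subrr t); apply: cvgB; last exact: cvg_cst.
    by apply: cvg_within_filter; apply: cvg_within_filter; exact: cvg_id.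
  have : (fun s => 2 * dot (x t) (Q *m q s) + (s - t) * dot (q s) (Q *m q s) : R^o)
      @ within T t^' --> (2 * dot (x t) (Q *m f t) + 0 * dot (f t) (Q *m f t) : R^o).
    apply: cvgD; apply: cvgM; [exact: cvg_cst| |exact: st|].
    - by apply: dot_mulmx_cvg => //; exact: cvg_cst.
    - exact: dot_mulmx_cvg.
  move=> /cvgr_le/(_ (e - a * dot (x t) (Q *m x t))).
  have := decr t Tt t0t; rewrite mu0 mulNr => dt.
  have -> : e - a * dot (x t) (Q *m x t) >
    2 * dot (x t) (Q *m f t) + 0 * dot (f t) (Q *m f t).
    by rewrite (le_lt_trans dt)// addrC ltrDl.
  move=> /(_ isT); apply: filterS => s qs ts.
  have -> : x s = x t + (s - t) *: q s.
    rewrite /q scalerA -[s - t]opprB mulNr divff ?scaleN1r ?subr_eq0 ?lt_eqF//.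
    by rewrite opprB addrC subrK.
  by rewrite quadratic_step// lerD2l ler_wpM2l// subr_ge0 ltW.
Qed.

Lemma enorm_sqr n (x : 'cV[R]_n.+1) : enorm x ^+ 2 = dot x x.
Proof.
rewrite sqr_sqrtr; first by rewrite dotE; apply: eq_bigr => i _; rewrite expr2.
by rewrite sumr_ge0// => i _; rewrite sqr_ge0.
Qed.

Lemma enorm_ge0 n (x : 'cV[R]_n.+1) : 0 <= enorm x.
Proof. exact: sqrtr_ge0. Qed.

End trajectories.

Theorem theorem5p1 (R : realType) (n m : nat)
    (A : 'M[R]_n.+1) (B : 'M[R]_(n.+1, m.+1)) (C : 'M[R]_(m.+1, n.+1))
    (T : set R) (k : R -> R) (eps1 : R)
    (hmin : minimum_phase A B C)
    (hpos : pos_def ((C *m B)^T + C *m B))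
    (hT : time_scale T) (hT0 : T 0) (hTunb : ~ has_ubound T)
    (heps1 : 0 < eps1)
    (hmubar_gt0 : forall t, T t -> 0 < mubar B C k eps1 t)
    (hmu : forall t, T t -> mu T t <= mubar B C k eps1 t)
    (hk : class_K T k)
    (hstab : exists2 tstar, T tstar &
       forall t, T t -> tstar <= t -> hurwitz (A - k t *: (B *m C))) :
  exists t0 K alpha : R,
    [/\ T t0, 0 <= t0, 1 <= K, 0 < alpha &
      forall (x0 : 'cV[R]_n.+1) (x : R -> 'cV[R]_n.+1),
        closed_loop_solution T A B C k x0 x ->
        forall t, T t -> t0 <= t ->
          enorm (x t) <= enorm (x t0) * K * expR (- (2^-1 * alpha * (t - t0)))].
Proof.
have [Q [c [a [k0 [r0 [c0 a0 k00 r00 [Qsym Qc decr]]]]]]] :=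
  closed_loop_quadratic hmin hpos heps1.
have [nQ nQ0 HQ] := dot_mulmx_bounded Q.
have Qup (y : 'cV[R]_n.+1) : dot y (Q *m y) <= nQ * dot y y.
  apply: (le_trans (ler_norm _)); apply: (le_trans (HQ _ _)).
  by rewrite ler_wpM2l ?(ltW nQ0)// -expr2 norm_le_dot.
have Q0 (y : 'cV[R]_n.+1) : 0 <= dot y (Q *m y).
  by rewrite (le_trans _ (Qc y))// mulr_ge0 ?dot_ge0// ltW.
pose q := lambda_min (C *m B + (C *m B)^T) / lambda_max ((C *m B)^T *m (C *m B))
  - eps1.
have [t0 [Tt0 t00 kt0]] := class_K_eventually_ge (Order.max k0 (q / r0)) hTunb hk.
have [Tne Tcl] := hT.
pose T0 := T `&` [set t | 0 <= t].
have T0cl : closed T0.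
  by apply: closedI => //; exact: closed_ge.
have T0unb : ~ has_ubound T0.
  move=> [M MT0]; apply: hTunb; exists (Order.max M 0) => s Ts.
  rewrite le_max; have [s0|s0] := leP 0 s; last by rewrite (ltW s0) orbT.
  by rewrite MT0.
exists t0, (Num.sqrt (nQ / c + 1)), (a / 2); split => //.
- by rewrite -[X in X <= _]sqrtr1 ler_wsqrtr// lerDr divr_ge0 ?(ltW nQ0)// ltW.
- by rewrite divr_gt0.
move=> x0 x [_ xsol] t Tt t0t.
have decay : dot (x t) (Q *m x t) <=
    dot (x t0) (Q *m x t0) * expR (- (a / 2 * (t - t0))).
  apply: (quadratic_decay (T := T0)
    (f := fun t => expc (mu T t *: A) *m (A - k t *: (B *m C)) *m x t)) => //.
  - by move=> s Ts _; exact: xsol.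
  - move=> s [Ts s0] t0s; rewrite mu_nonneg_part//.
    have := kt0 s Ts t0s; rewrite ge_max => /andP[kk0 kq].
    have mus := hmu s Ts.
    apply: (decr (k s)) => //.
    + by rewrite subr_ge0 sigma_ge.
    + apply: (le_trans mus); rewrite /mubar -/q mulrC ler_pdivrMr.
        by rewrite mulrC -ler_pdivrMr.
      exact: lt_le_trans kk0.
  - by split => //; exact: le_trans t0t.
rewrite -(@ler_pXn2r _ 2) ?nnegrE ?mulr_ge0 ?enorm_ge0 ?sqrtr_ge0 ?expR_ge0//.
rewrite !exprMn !enorm_sqr sqr_sqrtr; last first.
  by rewrite addr_ge0// divr_ge0// ltW.
rewrite -expRM_natl.
have -> : 2%:R * - (2^-1 * (a / 2) * (t - t0)) = - (a / 2 * (t - t0)) by field.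
set E := expR _ in decay *.
have E0 : 0 <= E by exact: expR_ge0.
rewrite -(ler_pM2l c0) (le_trans (Qc _))// (le_trans decay)//.
rewrite mulrA ler_wpM2r// (le_trans (Qup _))//.
rewrite mulrCA [nQ * _]mulrC ler_wpM2l ?dot_ge0//.
by rewrite mulrDr mulrCA divff ?gt_eqF// !mulr1 lerDl ltW.
Qed.
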